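(* Let $Q$ be a quandle. The following statements are equivalent: (1) $Q$ is affine; (2) $\mathrm{Dis}(Q)$ is abelian and semiregular, and the multiset $\{\{L_aL_e^{-1}:a\in T\}\}$ is balanced for every $e\in Q$ and every transversal $T$ of the orbit decomposition of $Q$; (2') $\mathrm{Dis}(Q)$ is abelian and semiregular, and the multiset $\{\{L_aL_e^{-1}:a\in T\}\}$ is balanced for some $e\in Q$ and some transversal $T$ of the orbit decomposition of $Q$; (3) $Q$ is isomorphic to $\mathrm{Ext}(A,f,\bar d)$ for some abelian group $A$, some automorphism $f$ of $A$ and some balanced tuple $\bar d=(d_i:i\in I)$ of elements of $A$ (and in that case the extension can be taken indecomposable).
   Context: A quandle is a nonempty set $Q$ with a binary operation $*$ such that $x*x=x$; for all $x,y$ there is a unique $z$ with $x*z=y$; and $x*(y*z)=(x*y)*(x*z)$. Left translations are $L_x(y)=x*y$. The displacement group is the permutation group $\mathrm{Dis}(Q)=\langle L_aL_b^{-1}: a,b\in Q\rangle$ on $Q$; the orbits of $Q$ are the orbits of $\mathrm{Dis}(Q)$ on $Q$, and they form the orbit decomposition of $Q$. A permutation group $G$ on $X$ is semiregular if $g(x)\ne x$ for every $1\neq g\in G$ and every $x\in X$. For an abelian group $A$ and $f\in\mathrm{Aut}(A)$, $\mathrm{Aff}(A,f)$ is the quandle on $A$ with $a*b=(1-f)(a)+f(b)$ ($1$ is the identity map). A quandle is affine if it is isomorphic to some $\mathrm{Aff}(A,f)$. For an abelian group $A$, $f\in\mathrm{Aut}(A)$, a nonempty set $I$ and a tuple $\bar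 d=(d_i:i\in I)$ of elements of $A$, $\mathrm{Ext}(A,f,\bar d)$ is the quandle on $I\times A$ with $(i,a)*(j,b)=(j,(1-f)(a)+f(b)+d_i-d_j)$. It is indecomposable if its orbits are exactly the fibers $\{i\}\times A$, $i\in I$. For a group $G$ and a subgroup $H$, a multiset (or tuple, regarded as a multiset) of elements of $G$ is a multitransversal of $G/H$ if every left coset of $H$ contains the same number (a cardinal, counting repetitions) of its elements. The commutator is $[x,y]=xyx^{-1}y^{-1}$ and $[\mathrm{Dis}(Q),L_e]$ is the subgroup generated by all $[\alpha,L_e]$, $\alpha\in\mathrm{Dis}(Q)$. The multiset $\{\{L_aL_e^{-1}:a\in T\}\}$ (indexed by $a\in T$, so counted with repetitions) is balanced if it is a multitransversal of $\mathrm{Dis}(Q)/[\mathrm{Dis}(Q),L_e]$. The tuple $\bar d$ of elements of $A$ is balanced (with respect to $f$) if it is a multitransversal of $A/\mathrm{Im}(1-f)$. *)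

(* Defs.v *)
From HB Require Import structures.
From mathcomp Require Import all_boot all_algebra.
From mathcomp Require Import boolp classical_sets functions cardinality.

Set Implicit Arguments.
Unset Strict Implicit.
Unset Printing Implicit Defensive.

Import GRing.Theory.

Local Open Scope classical_set_scope.
Local Open Scope card_scope.

(* [sym T] is the group of all permutations of an arbitrary, possibly infinite,
   type.  Unlike in [fingroup.perm], [g * h] applies [h] first. *)

Record sym (T : Type) := Sym { symval :> T -> T; sym_bij : bijective symval }.

HB.instance Definition _ (T : Type) := gen_eqMixin (sym T).
HB.instance Definition _ (T : Type) := gen_choiceMixin (sym T).

Section SymGroup.
Variable T : Type.
Implicit Types g h k : sym T.

Lemma symP g h : g =1 h -> g = h.
Proof.
case: g h => [g gP] [h hP] /= /funext gh.
by case: _ / gh in hP *; congr Sym; exact: Prop_irrelevance.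
Qed.

Definition sym_one : sym T := Sym (Bijective (frefl id) (frefl id)).

Definition sym_mul g h : sym T := Sym (bij_comp (sym_bij g) (sym_bij h)).

Fact sym_inv_subproof g :
  exists h : sym T, cancel g h /\ cancel h g.
Proof. by case: (sym_bij g) => h gK hK; exists (Sym (Bijective hK gK)). Qed.

Definition sym_inv g : sym T := projT1 (cid (sym_inv_subproof g)).

Fact sym_mulA : associative sym_mul.
Proof. by move=> g h k; apply: symP. Qed.

Fact sym_mul1g : left_id sym_one sym_mul.
Proof. by move=> g; apply: symP. Qed.

Fact sym_mulg1 : right_id sym_one sym_mul.
Proof. by move=> g; apply: symP. Qed.

Fact sym_mulVg : left_inverse sym_one sym_inv sym_mul.
Proof.
by move=> g; apply: symP => x; rewrite /sym_inv; case: cid => h [gK hK] /=.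
Qed.

Fact sym_mulgV : right_inverse sym_one sym_inv sym_mul.
Proof.
by move=> g; apply: symP => x; rewrite /sym_inv; case: cid => h [gK hK] /=.
Qed.

HB.instance Definition _ := isGroup.Build (sym T)
  sym_mulA sym_mul1g sym_mulg1 sym_mulVg sym_mulgV.

End SymGroup.

Local Open Scope group_scope.

Definition is_subgroup (gT : groupType) (H : set gT) : Prop :=
  group_closed (mem H).

Definition generated (gT : groupType) (S : set gT) : set gT :=
  smallest (@is_subgroup gT) S.

Definition abelian_set (gT : groupType) (G : set gT) : Prop :=
  forall x y, G x -> G y -> x * y = y * x.

(* The library's [[~ x, y]] is [x^-1 * y^-1 * x * y]. *)
Definition commutator (gT : groupType) (x y : gT) : gT := x * y * x^-1 * y^-1.

Definition left_cosets (gT : groupType) (G H : set gT) : set (set gT) :=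
  [set [set x * h | h in H] | x in G].

Definition add_cosets (A : zmodType) (H : set A) : set (set A) :=
  [set [set (a + h)%R | h in H] | a in [set: A]].

(* A multiset is a family [t], indexed by [D : set I]; the number of its
   elements in [C] is the cardinality of the set of indices sent to [C]. *)
Definition equidistributed (T I : Type) (P : set (set T)) (D : set I)
    (t : I -> T) : Prop :=
  forall C C' : set T, P C -> P C' ->
    (D `&` t @^-1` C) #= (D `&` t @^-1` C').

Definition multitransversal (gT : groupType) (G H : set gT) (I : Type)
    (D : set I) (t : I -> gT) : Prop :=
  (forall i, D i -> G (t i)) /\ equidistributed (left_cosets G H) D t.

Definition add_multitransversal (A : zmodType) (H : set A) (I : Type)
    (D : set I) (t : I -> A) : Prop :=
  equidistributed (add_cosets H) D t.

Section PermGroups.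
Variables (T : Type) (G : set (sym T)).

Definition semiregular : Prop :=
  forall g, G g -> g <> 1 -> forall x, g x <> x.

Definition orbit_of (x : T) : set T := [set g x | g in G].

Definition orbit_decomposition : set (set T) := range orbit_of.

End PermGroups.

Definition transversal_of (T : Type) (P : set (set T)) (X : set T) : Prop :=
  forall O, P O -> exists! a, X a /\ O a.

HB.mixin Record isQuandle (Q : Type) := {
  qop : Q -> Q -> Q;
  quandle_inhabited : inhabited Q;
  qopxx : forall x, qop x x = x;
  qop_div : forall x y, exists! z, qop x z = y;
  qop_dist : forall x y z, qop x (qop y z) = qop (qop x y) (qop x z)
}.

#[short(type="quandleType")]
HB.structure Definition Quandle := { Q of isQuandle Q }.

Notation "x |> y" := (qop x y) (at level 40, left associativity).

Definition quandle_iso (Q R : quandleType) : Prop :=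
  exists2 h : Q -> R, bijective h & forall x y, h (x |> y) = h x |> h y.

Section QuandleGroups.
Variable Q : quandleType.

Fact ltrans_bij (x : Q) : bijective (qop x).
Proof.
pose g y := projT1 (cid (qop_div x y)).
have gP y : x |> g y = y by rewrite /g; case: cid => z [].
exists g => // y; have [z [_ zU]] := qop_div x (x |> y).
by rewrite -(zU _ (gP _)) (zU y).
Qed.

Definition ltrans (x : Q) : sym Q := Sym (ltrans_bij x).

Definition Dis : set (sym Q) :=
  generated [set ltrans p.1 * (ltrans p.2)^-1 | p in [set: Q * Q]].

Definition quandle_orbits : set (set Q) := orbit_decomposition Dis.

Definition Dis_comm (e : Q) : set (sym Q) :=
  generated [set commutator g (ltrans e) | g in Dis].

Definition quandle_balanced (e : Q) (X : set Q) : Prop :=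
  multitransversal Dis (Dis_comm e) X (fun a => ltrans a * (ltrans e)^-1).

End QuandleGroups.

Arguments Dis : clear implicits.
Arguments quandle_orbits : clear implicits.

Local Open Scope ring_scope.

Record zmodAut (A : zmodType) :=
  ZmodAut { autval :> {additive A -> A}; aut_bij : bijective autval }.

Definition sub1_image (A : zmodType) (f : zmodAut A) : set A :=
  range (fun a => a - f a).

Section ZmodIdentities.
Variables (A : zmodType) (f : {additive A -> A}).
Implicit Types a b c u v w : A.

Fact sub1D a b : a - f a + f b = a + f (b - a).
Proof. by rewrite raddfB -addrA [- f a + _]addrC. Qed.

Fact addrDsub a u v : a + u - (a + v) = u - v.
Proof. by rewrite opprD addrACA subrr add0r. Qed.

Fact subrBB a b c : f (c - a) - f (b - a) = f (c - b).
Proof. by rewrite -raddfB opprB addrA subrK. Qed.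

End ZmodIdentities.

Definition Aff (A : zmodType) (f : zmodAut A) : Type := A.

Section AffQuandle.
Variables (A : zmodType) (f : zmodAut A).

Definition aff_op (a b : Aff f) : Aff f := ((a : A) - f a) + f b.

Fact aff_opxx a : aff_op a a = a.
Proof. exact: subrK. Qed.

Fact aff_op_div a b : exists! c, aff_op a c = b.
Proof.
have [g fK gK] := aut_bij f; exists (g ((b : A) - (a - f a))); split.
  by rewrite /aff_op gK addrC subrK.
by move=> c <-; rewrite /aff_op [X in X - _]addrC addrK fK.
Qed.

Fact aff_op_dist a b c :
  aff_op a (aff_op b c) = aff_op (aff_op a b) (aff_op a c).
Proof.
rewrite /aff_op !sub1D addrDsub subrBB.
by rewrite [b + _ - _]addrAC [in LHS]raddfD addrA.
Qed.

Fact aff_inhabited : inhabited (Aff f).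
Proof. by exists; exact: (0 : A). Qed.

HB.instance Definition _ := isQuandle.Build (Aff f)
  aff_inhabited aff_opxx aff_op_div aff_op_dist.

End AffQuandle.

Definition affine (Q : quandleType) : Prop :=
  exists (A : zmodType) (f : zmodAut A), quandle_iso Q (Aff f).

Definition Ext (I : Type) (I0 : inhabited I) (A : zmodType) (f : zmodAut A)
  (d : I -> A) : Type := (I * A)%type.

Section ExtQuandle.
Variables (I : Type) (I0 : inhabited I) (A : zmodType) (f : zmodAut A).
Variable d : I -> A.

Local Notation E := (Ext I0 f d).

Definition ext_op (p q : E) : E :=
  (q.1, (p.2 - f p.2) + f q.2 + d p.1 - d q.1).

Fact ext_inhabited : inhabited E.
Proof. by case: I0 => i; exists; exact: (i, 0). Qed.

Fact ext_opxx p : ext_op p p = p.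
Proof. by case: p => i a; rewrite /ext_op /= subrK addrK. Qed.

Fact ext_op_div p q : exists! r, ext_op p r = q.
Proof.
have [g fK gK] := aut_bij f; case: p q => i a [j b].
pose c := a - f a; exists (j, g (b - (d i - d j) - c)); split.
  by rewrite /ext_op /= gK -/c -addrA [c + _]addrC subrK subrK.
case=> k z [<- <-]; congr (_, _).
by rewrite -/c -[c + f z + _ - _]addrA addrK [c + _]addrC addrK fK.
Qed.

Fact ext_op_dist p q r :
  ext_op p (ext_op q r) = ext_op (ext_op p q) (ext_op p r).
Proof.
case: p q r => [i a] [j b] [k c]; rewrite /ext_op /= !sub1D; congr (_, _).
rewrite -![_ + d _ - d _]addrA.
set h := d i; set e := d j; set g := d k.
have -> : a + f (c - a) + (h - g) - (a + f (b - a) + (h - e)) =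
    f (c - b) + (e - g).
  by rewrite opprD addrACA addrDsub subrBB opprB [h - g + _]addrC subrKA.
rewrite [a + _ + (h - e) + _]addrAC -[RHS]addrA subrKA; congr (_ + _).
by rewrite -[a + _ + _]addrA -raddfD [in RHS]addrA [b - a + _]addrAC
           [in RHS]addrAC.
Qed.

HB.instance Definition _ := isQuandle.Build E
  ext_inhabited ext_opxx ext_op_div ext_op_dist.

End ExtQuandle.

Definition ext_fiber (I : Type) (I0 : inhabited I) (A : zmodType)
    (f : zmodAut A) (d : I -> A) (i : I) : set (Ext I0 f d) :=
  [set p | p.1 = i].

Definition indecomposable (I : Type) (I0 : inhabited I) (A : zmodType)
    (f : zmodAut A) (d : I -> A) : Prop :=
  quandle_orbits (Ext I0 f d) = range (@ext_fiber I I0 A f d).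

Definition tuple_balanced (A : zmodType) (f : zmodAut A) (I : Type)
    (d : I -> A) : Prop :=
  add_multitransversal (sub1_image f) [set: I] d.

(* Main.v *)
Require Import Defs.
From HB Require Import structures.
From mathcomp Require Import all_boot all_algebra.
From mathcomp Require Import boolp classical_sets functions cardinality.
From mathcomp Require Import ring_quotient.
From mathcomp.multinomials Require Import freeg.

Set Implicit Arguments.
Unset Strict Implicit.
Unset Printing Implicit Defensive.

Import GRing.Theory.

(** The classical part of the equivalence is a computation.  In an affine quandle
    with phi = 1 - f, the displacements are exactly the translations by the
    elements of Im phi, the orbits are the cosets of Im phi, and the subgroup
    generated by the commutators with a left translation consists of the
    translations by Im phi^2.  Translating a transversal by a constant then
    exchanges any two cosets, which gives balance ([affine_balanced]).
    Conversely, if Dis(Q) is abelian and semiregular, every point of Q is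
    uniquely [g a] with g in Dis(Q) and a in the transversal, and
    (a, g) |-> g a identifies Q with an extension of the group Dis(Q) by the
    tuple of the L_a L_e^-1, with conjugation by L_e as automorphism
    ([Dis_balanced_ext]).

    The substance is that a balanced extension Ext(A, f, d) is affine
    ([balanced_ext_affine]).  Two ingredients are needed.

    - Suppose that B contains A and that Phi : B -> A is onto, extends
      phi = 1 - f, and has its kernel inside A.  Then 1 - Phi is an automorphism
      of B extending f; choosing c_i in B with Phi c_i = d_i, the map
      (i, a) |-> c_i + a is a homomorphism from Ext(A, f, d) to Aff(B, 1 - Phi).
      Such a B exists because an arbitrary homomorphism of abelian groups factors
      as a monomorphism followed by an epimorphism without changing the kernel or
      the cokernel ([factor_mono_epi]); the obstruction would live in Ext^2 over
      the integers, which vanishes.  Concretely, a homomorphism defined on a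
      subgroup of a free abelian group lifts through any surjection
      ([lift_subgroup_of_free]).

    - The map above is a bijection only when the d_i form a transversal of
      A / Im phi.  In general each coset of Im phi contains kappa of the d_i for a
      fixed cardinal kappa > 0, and B is multiplied by an abelian group with
      kappa elements on which the automorphism acts trivially; the second
      coordinate tells apart the indices i whose d_i lie in the same coset
      ([balanced_labels]).  This uses that every inhabited type carries an abelian
      group structure ([zmod_of_inhabited]).

    Finally, the indecomposable form in the last claim comes for free: going round
    the cycle of implications produces the extension of Dis(Q), whose fibers are
    the orbits. *)

(** * Zorn's lemma for partially defined maps *)

Section PartialMaps.
Local Open Scope classical_set_scope.
Variables (B X Y : Type) (D : set B -> set X).

(** A pair (S, h) stands for a map defined on [D S] only: the values of [h]
    elsewhere are junk, which [extends] ignores. *)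
Definition extends (s t : set B * (X -> Y)) : Prop :=
  s.1 `<=` t.1 /\ forall x, D s.1 x -> s.2 x = t.2 x.

(** Total functions with junk values do not form a partial order under [extends],
    only a preorder, so the conclusion only compares the carriers.  The values of
    the maps in a chain are glued by choice, which is why closure under unions is
    required for every [h] that agrees with all the members of the chain. *)
Lemma partial_map_Zorn (P : set B -> (X -> Y) -> Prop) :
  (forall S S', S `<=` S' -> D S `<=` D S') ->
  (exists S h, P S h) ->
  (forall C : set (set B * (X -> Y)), C !=set0 ->
     (forall s, C s -> P s.1 s.2) ->
     total_on C extends ->
     forall h, (forall s, C s -> extends s (\bigcup_(s in C) s.1, h)) ->
     P (\bigcup_(s in C) s.1) h) ->
  exists S h, P S h /\
    forall S' h', P S' h' -> extends (S, h) (S', h') -> S' `<=` S.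
Proof.
move=> Dmono [S0 [h0 P0]] Punion.
pose T := {s : set B * (X -> Y) | P s.1 s.2}.
pose t0 : T := exist _ (S0, h0) P0.
pose R (s t : T) := `[< extends (sval s) (sval t) >].
have [|||t tmax] := @ZL_preorder T t0 R.
- by move=> s; apply/asboolP; split.
- move=> s r t /asboolP[rs rsE] /asboolP[st stE]; apply/asboolP; split.
    by move=> x /rs/st.
  by move=> x Dx; rewrite rsE // stE //; apply: Dmono Dx.
- move=> A totA; have [[s0 As0]|nA] := pselect (A !=set0); last first.
    by exists t0 => s As; case: nA; exists s.
  pose C : set (set B * (X -> Y)) := [set sval s | s in A].
  have totC : total_on C extends.
    by move=> _ _ [s As <-] [t At <-]; case: (totA s t As At) => /asboolP;
       [left|right].
  pose h x := if pselect (exists2 s, A s & D (sval s).1 x) is left e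
              then (sval (s2val (cid2 e))).2 x else h0 x.
  have hE s : A s -> forall x, D (sval s).1 x -> (sval s).2 x = h x.
    move=> As x Dx; rewrite /h; case: pselect => [e|[]]; last by exists s.
    case: cid2 => t /= At Dt.
    by case: (totA s t As At) => /asboolP[_ ->].
  have Cext s : C s -> extends s (\bigcup_(s in C) s.1, h).
    move=> [s' As' <-]; split; last exact: hE.
    by move=> x sx; exists (sval s') => //; exists s'.
  have PC : P (\bigcup_(s in C) s.1) h.
    apply: Punion => //; first by exists (sval s0); exists s0.
    by move=> _ [s _ <-]; exact: (svalP s).
  exists (exist _ (\bigcup_(s in C) s.1, h) PC) => s As; apply/asboolP.
  by apply: Cext; exists s.
exists (sval t).1, (sval t).2; split; first exact: (svalP t).
move=> S' h' P' ext'.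
have /asboolP[] // : R (exist _ (S', h') P') t.
by apply: tmax; apply/asboolP; case: (t) ext' => -[].
Qed.

Lemma chain_pair (C : set (set B * (X -> Y))) s t :
  total_on C extends -> C s -> C t ->
  exists r, [/\ C r, s.1 `<=` r.1 & t.1 `<=` r.1].
Proof.
by move=> totC Cs Ct; case: (totC s t Cs Ct) => -[st _];
  [exists t|exists s]; split.
Qed.

End PartialMaps.

Section Chains.
Local Open Scope classical_set_scope.
Lemma chain_seq (B : eqType) (X Y : Type) (D : set B -> set X)
    (C : set (set B * (X -> Y))) (r : seq B) :
  C !=set0 -> total_on C (extends D) ->
  (forall x, x \in r -> (\bigcup_(s in C) s.1) x) ->
  exists s, C s /\ forall x, x \in r -> s.1 x.
Proof.
move=> [s0 Cs0] totC; elim: r => [|x r IH] rC; first by exists s0.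
have [|s [Cs sr]] := IH; first by move=> y ry; apply: rC; rewrite inE ry orbT.
have [|t Ct tx] := rC x; first by rewrite inE eqxx.
have [q [Cq sq tq]] := chain_pair totC Cs Ct.
by exists q; split => // y; rewrite inE => /orP[/eqP->|/sr/sq//]; exact: tq.
Qed.

End Chains.


(** * Factoring homomorphisms of abelian groups *)

Section IntSubgroups.
Local Open Scope classical_set_scope.
Local Open Scope ring_scope.

Lemma int_subgroup_principal (J : set int) :
  J 0 -> (forall m n, J m -> J n -> J (m - n)) ->
  exists2 n, J n & forall m, J m -> m = (m %/ n)%Z * n.
Proof.
move=> J0 JB.
have JN n : J n -> J (- n) by move=> Jn; rewrite -sub0r; exact: JB.
have JD m n : J m -> J n -> J (m + n).
  by move=> Jm Jn; rewrite -[n]opprK; exact/JB/JN.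
have JM n : J n -> forall k, J (k * n).
  move=> Jn; elim=> [|k IH|k IH]; first by rewrite mul0r.
    by rewrite intS mulrDl mul1r; exact: JD.
  by rewrite intS opprD mulrDl mulN1r; apply: JD => //; exact: JN.
have [[p [Jp p0]]|nJ] := 
    pselect (exists p : nat, J p%:Z /\ (p > 0)%N); last first.
  exists 0 => // m Jm; rewrite mulr0; case: m Jm => [[|m]|m] Jm //.
    by case: nJ; exists m.+1.
  case: nJ; exists m.+1; split => //.
  by rewrite -[Posz _]opprK -NegzE; exact: JN.
have exP : exists p : nat, (fun p : nat => `[< J p%:Z >] && (p > 0)%N) p.
  by exists p; rewrite p0 andbT; exact/asboolP.
case: (ex_minnP exP) => n /andP[/asboolP Jn n0] nmin.
exists n%:Z => // m Jm.
have Jr : J (m %% n)%Z.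
  by rewrite /modz; apply: JB => //; exact: JM.
have r0 : (0 <= m %% n)%Z by rewrite modz_ge0 // -lt0n.
have rn : (m %% n < n)%Z by rewrite ltz_pmod.
rewrite {1}(divz_eq m n); suff -> : (m %% n)%Z = 0 by rewrite addr0.
case: (m %% n)%Z r0 rn Jr => // -[//|r] _ rn Jr.
have := nmin r.+1; rewrite andbT => /(_ _)/wrap[|le_nr]; first exact/asboolP.
by move: rn; rewrite ltz_nat ltnNge le_nr.
Qed.

End IntSubgroups.

Section FreeLift.
Local Open Scope classical_set_scope.
Local Open Scope ring_scope.

(** Subgroups of free abelian groups are projective.  Instead of exhibiting a
    basis of R, the lift is extended one generator k at a time: the coefficients
    at k of the elements of R supported in S u {k} form a subgroup n Z of the
    integers, and an element r with coefficient n generates a complement of the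
    elements supported in S, on which the lift may be chosen freely. *)
Lemma lift_subgroup_of_free (K : choiceType) (A A' : zmodType)
    (phi : {additive A -> A'}) (p : {additive {freeg K / int} -> A'}) :
  let R x := range phi (p x) in
  exists lam : {freeg K / int} -> A,
    (forall x y, R x -> R y -> lam (x - y) = lam x - lam y) /\
    (forall x, R x -> phi (lam x) = p x).
Proof.
move=> R; pose F := {freeg K / int}.
have R0 : R 0 by exists 0 => //; rewrite !raddf0.
have RB x y : R x -> R y -> R (x - y).
  by move=> [a _ ax] [b _ bx]; exists (a - b); rewrite // !raddfB ax bx.
pose D (S : set K) : set F := [set x | R x /\ forall k, coeff k x != 0 -> S k].
have DB S x y : D S x -> D S y -> D S (x - y).
  move=> [Rx Sx] [Ry Sy]; split; first exact: RB.
  move=> k; rewrite coeffB; have [x0|/Sx//] := eqVneq (coeff k x) 0.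
  by rewrite x0 sub0r oppr_eq0 => /Sy.
have D0 S : D S 0 by split => // k; rewrite coeff0 eqxx.
pose P S (h : F -> A) :=
  (forall x y, D S x -> D S y -> h (x - y) = h x - h y) /\
  (forall x, D S x -> phi (h x) = p x).
have Dmono S S' : S `<=` S' -> D S `<=` D S'.
  by move=> SS' x [Rx Sx]; split => // k /Sx/SS'.
have [||S [h [[hB hp] hmax]]] := @partial_map_Zorn K F A D P Dmono.
- exists set0, (fun=> 0); rewrite /P.
  have z x : D set0 x -> x = 0.
    move=> [_ x0]; apply/eqP/freeg_eqP => k; rewrite coeff0.
    by apply/eqP/negP => /negP/x0.
  by split=> [x y|x /z ->]; rewrite ?subrr // !raddf0.
- move=> C C0 CP totC h hC.
  have DC x : D (\bigcup_(s in C) s.1) x -> exists s, C s /\ D s.1 x.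
    move=> [Rx Sx]; have [|s [Cs sx]] := chain_seq (r := dom x) C0 totC.
      by move=> k; rewrite mem_dom => /Sx.
    by exists s; split => //; split => // k; rewrite -mem_dom => /sx.
  split=> [x y /DC[s [Cs sx]] /DC[t [Ct ty]]|x /DC[s [Cs sx]]].
    have [r [Cr sr tr]] := chain_pair totC Cs Ct.
    move: sx ty => /(Dmono _ _ sr) rx /(Dmono _ _ tr) ry.
    have [_ /= rE] := hC _ Cr; rewrite -!rE //; last exact: DB.
    by have [rB _] := CP _ Cr; exact: rB.
  by have [_ /= <-//] := hC _ Cs; have [_] := CP _ Cs; apply.
suff ST k : S k.
  have DR x : R x -> D S x by move=> Rx; split.
  by exists h; split => [x y /DR ? /DR ?|x /DR ?]; [exact: hB|exact: hp].
pose S' := S `|` [set k]; pose J := [set coeff k x | x in D S'].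
have [||n [r Dr rn] Jn] := @int_subgroup_principal J.
- by exists 0; rewrite ?coeff0.
- move=> _ _ [x Dx <-] [y Dy <-]; exists (x - y); rewrite ?coeffB //.
  exact: DB.
have [b _ br] : R r by case: Dr.
(* When n = 0, division by zero returns 0, as it should: then D S' = D S. *)
pose q x := (coeff k x %/ n)%Z.
have qE x : D S' x -> coeff k x = q x * n by move=> Dx; apply: Jn; exists x.
have DM T x m : D T x -> D T (x *~ m).
  have DMn i : D T x -> D T (x *+ i).
    elim: i => [|i IH] Dx; rewrite ?mulr0n // mulrS -[x *+ i]opprK.
    by apply: (DB) => //; rewrite -sub0r; apply: (DB) => //; exact: IH.
  move=> Dx; case: m => m; first exact: DMn.
  by rewrite NegzE mulrNz -sub0r; apply: (DB) => //; exact: DMn.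
apply: contrapT => nSk.
pose g x := x - r *~ q x.
have Dg x : D S' x -> D S (g x).
  move=> Dx; have [Rg Sg] : D S' (g x) by apply: (DB) => //; exact: DM.
  split=> // j gj; have [//|jk] := Sg _ gj; move: gj.
  by rewrite jk coeffB raddfMz /= rn -mulrzl intz -qE // subrr eqxx.
have qB x y : D S' x -> D S' y -> q (x - y) = q x - q y.
  move=> Dx Dy; have [n0|n0] := eqVneq n 0.
    by rewrite /q n0 !divz0.
  by apply: (mulIf n0); rewrite mulrBl -!qE ?coeffB //; exact: DB.
have gB x y : D S' x -> D S' y -> g (x - y) = g x - g y.
  move=> Dx Dy; rewrite /g qB // mulrzBr !opprB.
  by rewrite addrACA [RHS]addrACA [- y - _]addrC.
apply: (nSk); apply: (hmax S' (fun x => h (g x) + b *~ q x)); last by right.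
  split=> [x y Dx Dy|x Dx].
    by rewrite gB // (hB _ _ (Dg _ Dx) (Dg _ Dy)) qB // mulrzBr opprD addrACA.
  by rewrite raddfD /= (hp _ (Dg _ Dx)) !raddfMz /= br raddfB raddfMz subrK.
split=> [x Sx|x [Rx Sx] /=]; first by left.
have q0 : q x = 0.
  rewrite /q; suff -> : coeff k x = 0 by rewrite div0z.
  by apply/eqP/negP => /negP/Sx.
by rewrite /g q0 !mulr0z subr0 addr0.
Qed.

Lemma quotient_exists (V : zmodType) (L : set V) :
  L 0 -> (forall x y, L x -> L y -> L (x - y)) ->
  exists (W : zmodType) (p : {additive V -> W}),
    (forall w, exists v, p v = w) /\ forall v, p v = 0 <-> L v.
Proof.
move=> L0 LB.
pose S : {pred V} := fun v => `[< L v >].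
have Sclosed : zmod_closed S.
  split=> [|x y]; first exact/asboolP.
  by move=> /asboolP Lx /asboolP Ly; apply/asboolP; exact: LB.
pose I : zmodClosed V := HB.pack S (GRing.isZmodClosed.Build V S Sclosed).
pose pi : {additive V -> Quotient.quot I} := \pi_(Quotient.quot I)%qT.
exists (Quotient.quot I), pi; split.
  by move=> w; exists (repr w); exact: reprK.
move=> v; rewrite -(raddf0 pi); split=> [/eqP|Lv]; last apply/eqP; rewrite /pi.
  by rewrite /= -Quotient.idealrBE subr0 => /asboolP.
by rewrite /= -Quotient.idealrBE subr0; exact/asboolP.
Qed.

(** Take F free with p : F -> A' onto, and lift p over p^-1 (Im phi) to a map lam
    into A.  Then B is the quotient of A x F that identifies each x in
    p^-1 (Im phi) with lam x; the relation is a graph, so A embeds in B, and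
    phi + p is onto with no more kernel than phi. *)
Lemma factor_mono_epi (A A' : zmodType) (phi : {additive A -> A'}) :
  exists (B : zmodType) (iota : {additive A -> B}) (Phi : {additive B -> A'}),
    [/\ injective iota, (forall a', exists b, Phi b = a'),
        (forall a, Phi (iota a) = phi a) &
        forall b, Phi b = 0 -> exists a, iota a = b].
Proof.
pose F := {freeg A' / int}.
have [p p_onto] : exists p : {additive F -> A'}, forall a', p << a' >> = a'.
  pose p0 : F -> A' := fglift (R := int) (M := zmodule A') id.
  pose p : {additive F -> A'} := HB.pack p0
    (GRing.isZmodMorphism.Build F A' p0
      (lift_is_additive (M := zmodule A') id)).
  by exists p => a'; rewrite /p /= /p0 liftU scale1r.
have [lam [lamB phi_lam]] := lift_subgroup_of_free phi p.
have R0 : range phi (p 0) by exists 0; rewrite // !raddf0.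
have lam0 : lam 0 = 0 by have := lamB 0 0 R0 R0; rewrite !subrr.
pose V := (A * F)%type.
pose L : set V := [set v | range phi (p v.2) /\ v.1 = - lam v.2].
have [|[a x] [b y]|B [q [q_onto q0]]] := @quotient_exists V L.
- by split; rewrite //= lam0 oppr0.
- move=> [/= Rx ->] [/= Ry ->]; split => /=; last first.
    by rewrite lamB // opprB opprK addrC.
  move: Rx Ry => [c _ cE] [d _ dE].
  by exists (c - d); rewrite // !raddfB cE dE.
pose psi (v : V) := phi v.1 + p v.2.
have psiB u v : psi (u - v) = psi u - psi v.
  by rewrite /psi /= !raddfB opprD addrACA.
have psiL v : L v -> psi v = 0.
  by move=> [Rv v1]; rewrite /psi v1 raddfN /= phi_lam // addNr.
have [s sK] : exists s : B -> V, forall b, q (s b) = b.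
  by have [s sK] := choice q_onto; exists s.
pose Phi0 b := psi (s b).
have Phi0q v : Phi0 (q v) = psi v.
  apply/eqP; rewrite -subr_eq0 -psiB; apply/eqP/psiL/q0.
  by rewrite raddfB /= sK subrr.
have Phi0B : zmod_morphism Phi0.
  by move=> b c; rewrite -{1}[b]sK -{1}[c]sK -raddfB Phi0q psiB.
pose Phi : {additive B -> A'} := HB.pack Phi0
  (GRing.isZmodMorphism.Build B A' Phi0 Phi0B).
pose iota0 a : B := q (a, 0).
have iota0B : zmod_morphism iota0.
  by move=> a b; rewrite /iota0 -raddfB; congr (q (_, _)); rewrite subr0.
pose iota : {additive A -> B} := HB.pack iota0
  (GRing.isZmodMorphism.Build A B iota0 iota0B).
exists B, iota, Phi; split.
- apply: raddf_inj => a /q0[/= _ ->].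
  by rewrite lam0 oppr0.
- move=> a'; exists (q (0, << a' >>)).
  by rewrite /= Phi0q /psi /= raddf0 add0r p_onto.
- by move=> a; rewrite /= Phi0q /psi /= raddf0 addr0.
- move=> b; rewrite -[b]sK; case: (s b) => a x; rewrite /= Phi0q /psi /= => e.
  have Rx : range phi (p x).
    by exists (- a) => //; apply/eqP; rewrite raddfN eq_sym -addr_eq0 addrC e.
  exists (a + lam x); apply/eqP; rewrite -subr_eq0 /= /iota0 -raddfB.
  apply/eqP/q0; split; rewrite /= sub0r.
    by exists a; rewrite // raddfN; apply/eqP; rewrite -addr_eq0 e.
  by rewrite addrAC subrr add0r -[- x]sub0r lamB // lam0 sub0r opprK.
Qed.

End FreeLift.

(** * Abelian group structures on arbitrary types *)

Section GroupOnType.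
Local Open Scope classical_set_scope.
Local Open Scope card_scope.
Local Open Scope ring_scope.

Lemma card_le_inj (T U : Type) (A : set T) (B : set U) (f : T -> U) :
  (forall x, A x -> B (f x)) ->
  (forall x y, A x -> A y -> f x = f y -> x = y) -> A #<= B.
Proof.
move=> fAB f_inj; have [g] : $|{injfun A >-> B}|; last exact: inj_card_le.
by apply/injfunPex; exists f => // x y /set_mem Ax /set_mem Ay; exact: f_inj.
Qed.

Lemma card_eqTT (T U : Type) :
  [set: T] #= [set: U] -> exists f : T -> U, bijective f.
Proof.
move=> /card_bijP[f [g fK gK]].
exists (fun x => val (f (SigSub (mem_set (I : setT x))))).
exists (fun x => val (g (SigSub (mem_set (I : setT x))))) => x.
  rewrite [X in g X](_ : _ = f (SigSub (mem_set (I : setT x)))) ?fK //.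
  exact: val_inj.
rewrite [X in f X](_ : _ = g (SigSub (mem_set (I : setT x)))) ?gK //.
exact: val_inj.
Qed.

Lemma injection_total (T : Type) (x0 : T) (A B : set T) :
  (exists f : T -> T, set_fun A B f /\ {in A &, injective f}) \/
  (exists f : T -> T, set_fun B A f /\ {in B &, injective f}).
Proof.
pose P (G : set (T * T)) := (forall p, G p -> A p.1 /\ B p.2) /\
  forall p q, G p -> G q -> p.1 = q.1 <-> p.2 = q.2.
have [|G [[GAB Ginj] Gmax]] := @Zorn_bigcup _ P.
  move=> F FP totF; split=> [p [G FG Gp]|p q [G FG Gp] [H FH Hq]].
    by have [GAB _] := FP _ FG; exact: GAB.
  by have [GH|HG] := totF _ _ FG FH;
    [have [_] := FP _ FH|have [_] := FP _ FG]; apply => //;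
    [exact: GH|exact: HG].
have [domG|/existsNP[a /not_implyP[Aa na]]] :=
    pselect (forall a, A a -> exists b, G (a, b)).
  left; have /choice[f fP] a : exists b, A a -> G (a, b).
    by have [/domG[b Gb]|nAa] := pselect (A a); [exists b|exists x0].
  exists f; split=> [a /fP/GAB[]//|a b /set_mem /fP Ga /set_mem /fP Gb fab].
  exact/(Ginj _ _ Ga Gb).
have [ranG|/existsNP[b /not_implyP[Bb nb]]] :=
    pselect (forall b, B b -> exists a, G (a, b)).
  right; have /choice[f fP] b : exists a, B b -> G (a, b).
    by have [/ranG[c Gc]|nBb] := pselect (B b); [exists c|exists x0].
  exists f; split=> [c /fP/GAB[]//|c d /set_mem /fP Gc /set_mem /fP Gd fcd].
  exact/(Ginj _ _ Gc Gd).
exfalso; apply: (Gmax (G `|` [set (a, b)])).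
  split; first by left.
  by move=> sub; apply: na; exists b; apply: sub; right.
split=> [p [/GAB//|->//]|p q [Gp|->] [Gq|->]] //; first exact: Ginj.
- split=> /= e; first by case: na; exists p.2; rewrite -e -surjective_pairing.
  by case: nb; exists p.1; rewrite -e -surjective_pairing.
- split=> /= e; first by case: na; exists q.2; rewrite e -surjective_pairing.
  by case: nb; exists q.1; rewrite e -surjective_pairing.
Qed.

(** An elementary abelian 2-group on S with an injection bool * S -> S.  The
    injection gives |S| + |S| = |S| without cardinal arithmetic.  Both
    operations are packed in one map on a sum type to fit [partial_map_Zorn],
    and the axioms are identities and Horn clauses, which pass to unions of
    chains. *)
Definition doubling_group (T : Type) (S : set T) (h : T * T + bool * T -> T) :=
  [/\ S !=set0,
      (forall x y, S x -> S y -> S (h (inl (x, y)))) /\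
        (forall b x, S x -> S (h (inr (b, x)))),
      (forall x y z, S x -> S y -> S z ->
         h (inl (x, h (inl (y, z)))) = h (inl (h (inl (x, y)), z))) /\
        (forall x y, S x -> S y -> h (inl (x, y)) = h (inl (y, x))),
      (forall x y, S x -> S y -> h (inl (h (inl (x, x)), y)) = y) &
      (forall b c x y, S x -> S y ->
         h (inr (b, x)) = h (inr (c, y)) -> b = c /\ x = y)].

Lemma boolean_zmod (T : Type) (op : T -> T -> T) : inhabited T ->
  associative op -> commutative op -> (forall x y, op (op x x) y = y) ->
  exists (G : zmodType) (e : T -> G), bijective e.
Proof.
move=> [x0] opA opC opxx.
pose Tc : choiceType := HB.pack T (gen_eqMixin T) (gen_choiceMixin T).
pose m := GRing.isZmodule.Build Tc (zero := op x0 x0) (opp := id) (add := op).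
have opN : @left_inverse T T T (op x0 x0) id op.
  by move=> x; rewrite /= -[RHS](opxx x) opC opxx.
pose G : zmodType := HB.pack Tc (m opA opC (opxx x0) opN).
by exists G, (id : T -> G); exists id.
Qed.

(** A copy j(S) of S disjoint from S turns S u j(S) into the product of S with the
    group of order 2; the injection acts on the first factor. *)
Lemma doubling_group_extend (T : Type) (S : set T) h (j : T -> T) :
  doubling_group S h -> (forall x, S x -> ~ S (j x)) ->
  (forall x y, S x -> S y -> j x = j y -> x = y) ->
  exists h', doubling_group (S `|` [set j x | x in S]) h' /\
    (forall x y, S x -> S y -> h (inl (x, y)) = h' (inl (x, y))) /\
    (forall b x, S x -> h (inr (b, x)) = h' (inr (b, x))).
Proof.
move=> [S0 [Sop Sp] [opA opC] opxx p_inj] nSj j_inj.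
pose S' := S `|` [set j x | x in S].
pose enc (u : T * bool) := if u.2 then j u.1 else u.1.
have /choice[dec decP] x : exists u, S' x -> S u.1 /\ enc u = x.
  have [Sx|nSx] := pselect (S x); first by exists (x, false).
  have [[y Sy <-]|nj] := pselect ([set j x | x in S] x).
    by exists (y, true).
  by exists (x, false) => -[/nSx|/nj].
have encS u : S u.1 -> S' (enc u).
  by case: u => u [] /= Su; rewrite /enc /=; [right; exists u|left].
have encK u : S u.1 -> dec (enc u) = u.
  move=> Su; have [] := decP _ (encS u Su); case: (dec _) => v b /=.
  case: u Su => u c /= Su Sv; case: b c => -[]; rewrite /enc /= => e.
  - by rewrite (j_inj _ _ Sv Su e).
  - by case: (nSj v); rewrite // e.
  - by case: (nSj u); rewrite // -e.
  - by rewrite e.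
pose h' z := match z with
  | inl (x, y) => enc (h (inl ((dec x).1, (dec y).1)), (dec x).2 (+) (dec y).2)
  | inr (b, x) => enc (h (inr (b, (dec x).1)), (dec x).2)
  end.
have dec1 x : S' x -> S (dec x).1 by move=> /decP[].
have encI x y : S' x -> S' y -> (dec x).1 = (dec y).1 ->
    (dec x).2 = (dec y).2 -> x = y.
  move=> /decP[_ ex] /decP[_ ey] e1 e2; rewrite -ex -ey.
  by rewrite [dec x]surjective_pairing [dec y]surjective_pairing e1 e2.
have h'l x y : S' x -> S' y -> S' (h' (inl (x, y))) /\
    dec (h' (inl (x, y))) =
      (h (inl ((dec x).1, (dec y).1)), (dec x).2 (+) (dec y).2).
  move=> /dec1 Sx /dec1 Sy.
  by split; [apply: encS|rewrite /h' encK] => //=; exact: Sop.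
have h'r b x : S' x -> S' (h' (inr (b, x))) /\
    dec (h' (inr (b, x))) = (h (inr (b, (dec x).1)), (dec x).2).
  by move=> /dec1 Sx; split; [apply: encS|rewrite /h' encK] => //=; exact: Sp.
exists h'; split; last split.
- split.
  + by case: S0 => x Sx; exists x; left.
  + by split=> [x y Sx Sy|b x Sx]; [case: (h'l x y Sx Sy)|case: (h'r b x Sx)].
  + split=> [x y z Sx Sy Sz|x y Sx Sy].
      have [Syz dyz] := h'l _ _ Sy Sz; have [Sxy dxy] := h'l _ _ Sx Sy.
      have [S1 d1] := h'l _ _ Sx Syz; have [S2 d2] := h'l _ _ Sxy Sz.
      apply: encI => //; rewrite d1 d2 dyz dxy /= ?addbA //.
      by apply: opA; exact: dec1.
    have [S1 d1] := h'l _ _ Sx Sy; have [S2 d2] := h'l _ _ Sy Sx.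
    apply: encI => //; rewrite d1 d2 /= 1?addbC //.
    by apply: opC; exact: dec1.
  + move=> x y Sx Sy; have [Sxx dxx] := h'l _ _ Sx Sx.
    have [S1 d1] := h'l _ _ Sxx Sy.
    apply: encI => //; rewrite d1 dxx /= ?addbb //.
    by apply: opxx; exact: dec1.
  + move=> b c x y Sx Sy e.
    have [_ d1] := h'r b x Sx; have [_ d2] := h'r c y Sy.
    move: d1; rewrite e d2 => -[e1 e2].
    have [-> e3] := p_inj _ _ _ _ (dec1 _ Sy) (dec1 _ Sx) e1.
    by split => //; exact: encI.
- move=> x y Sx Sy; rewrite /h'.
  by rewrite -[x]/(enc (x, false)) -[y]/(enc (y, false)) !encK.
- move=> b x Sx; rewrite /h'.
  by rewrite -[x]/(enc (x, false)) !encK.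
Qed.

Lemma doubling_group_transport (V T : Type) (V0 : inhabited V)
    (op : V -> V -> V) (p : bool -> V -> V) (u : V -> T) :
  injective u -> associative op -> commutative op ->
  (forall x y, op (op x x) y = y) ->
  (forall b c x y, p b x = p c y -> b = c /\ x = y) ->
  exists h, doubling_group (range u) h.
Proof.
move=> u_inj opA opC opxx p_inj; have [v0] := V0.
have /choice[v vP] t : exists x, range u t -> u x = t.
  by have [[x _ <-]|nt] := pselect (range u t); [exists x|exists v0].
have uK x : v (u x) = x by apply: u_inj; apply: vP; exists x.
exists (fun z => match z with
  | inl (x, y) => u (op (v x) (v y)) | inr (b, x) => u (p b (v x)) end).
split.
- by exists (u v0), v0.
- by split=> [x y _ _|b x _]; [exists (op (v x) (v y))|exists (p b (v x))].
- by split=> [x y z _ _ _|x y _ _]; rewrite ?uK ?opA // opC.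
- by move=> _ _ [x _ <-] [y _ <-]; rewrite !uK opxx.
- by move=> b c _ _ [x _ <-] [y _ <-]; rewrite !uK => /u_inj/p_inj[-> ->].
Qed.

(** Polynomials over the field with two elements are a countable model, with
    (b, q) |-> q X + b as injection. *)
Lemma infinite_doubling_group (T : Type) :
  infinite_set [set: T] -> exists S h, @doubling_group T S h.
Proof.
move=> Tinf; pose V := {poly 'F_2}.
have [n n_inj] : exists n : nat -> T, injective n.
  move: Tinf; elim/Ppointed: T => T; first by move=> []; rewrite emptyE.
  move=> /infiniteP/pcard_injP[n n_inj].
  by exists n => x y; apply: n_inj; rewrite inE.
exists (range (n \o (pickle : V -> nat))).
apply: (@doubling_group_transport V T _ +%R (fun b q => q * 'X + (b%:R)%:P)).
- by exists; exact: 0.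
- exact: inj_comp (pcan_inj (@pickleK V)).
- exact: addrA.
- exact: addrC.
- move=> x y; rewrite -mulr2n -mulr_natr.
  have -> : 2%:R = 0 :> V.
    rewrite -(rmorph_nat (@polyC 'F_2)) (_ : 2%:R = 0) ?rmorph0 //.
    exact/eqP.
  by rewrite mulr0 add0r.
- move=> b c x y e.
  have bc : b = c.
    move/(congr1 (fun q : V => q`_0)): e.
    rewrite /= !coefD !coefMX !coefC /= !add0r.
    by case: b c => -[].
  by split => //; move: e; rewrite bc => /addIr/(mulIf (negbT (polyX_eq0 _))).
Qed.

Lemma maximal_doubling_group (T : Type) : infinite_set [set: T] ->
  exists S h, @doubling_group T S h /\
    ~ exists j : T -> T, set_fun S (~` S) j /\ {in S &, injective j}.
Proof.
move=> /infinite_doubling_group dg0.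
pose D (S : set T) : set (T * T + bool * T) := fun z => match z with
  inl (x, y) => S x /\ S y | inr (b, x) => S x end.
have [||S [h [Sh hmax]]] := @partial_map_Zorn T _ T D (@doubling_group T) _ dg0.
- by move=> S S' SS' [[x y] [/SS' ? /SS' ?]|[b x] /SS' ?].
- move=> C C0 Cdg totC h hC.
  pose Tc : eqType := HB.pack T (gen_eqMixin T).
  have seqC (r : seq Tc) : (forall x, x \in r -> (\bigcup_(s in C) s.1) x) ->
      exists s, [/\ C s, doubling_group s.1 h & forall x, x \in r -> s.1 x].
    move=> rC; have [s [Cs sr]] := chain_seq (B := Tc) C0 totC rC.
    have [_ /= sh] := hC _ Cs; have [s0 [sop sp] [sA sK] sxx sinj] := Cdg _ Cs.
    have hl x y : s.1 x -> s.1 y -> h (inl (x, y)) = s.2 (inl (x, y)).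
      by move=> sx sy; rewrite sh.
    have hr b x : s.1 x -> h (inr (b, x)) = s.2 (inr (b, x)).
      by move=> sx; rewrite sh.
    exists s; split=> //; split=> //.
    + split=> [x y sx sy|b x sx]; first by rewrite hl //; exact: sop.
      by rewrite hr //; exact: sp.
    + split=> [x y z sx sy sz|x y sx sy]; last by rewrite !hl //; exact: sK.
      have [sxy syz] := (sop _ _ sx sy, sop _ _ sy sz).
      by rewrite (hl y z) // (hl x y) // (hl x) // (hl _ z) //; exact: sA.
    + move=> x y sx sy; have sxx' := sop _ _ sx sx.
      by rewrite (hl x x) // hl //; exact: sxx.
    + by move=> b c x y sx sy; rewrite !hr //; exact: sinj.
  have sub s : C s -> s.1 `<=` \bigcup_(s in C) s.1 by move=> Cs x sx; exists s.
  split.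
  + by have [s Cs] := C0; have [[x sx] _ _ _ _] := Cdg _ Cs; exists x, s.
  + split=> [x y Ux Uy|b x Ux].
      have [|s [Cs [_ [sop _] _ _ _] sr]] := seqC [:: x; y].
        by move=> z; rewrite !inE => /orP[]/eqP->.
      by apply: (sub _ Cs); apply: sop; apply: sr; rewrite !inE eqxx ?orbT.
    have [|s [Cs [_ [_ sp] _ _ _] sr]] := seqC [:: x].
      by move=> z; rewrite !inE => ->.
    by apply: (sub _ Cs); apply: sp; apply: sr; rewrite inE.
  + split=> [x y z Ux Uy Uz|x y Ux Uy].
      have [|s [Cs [_ _ [sA _] _ _] sr]] := seqC [:: x; y; z].
        by move=> t; rewrite !inE => /or3P[]/eqP->.
      by apply: sA; apply: sr; rewrite !inE eqxx ?orbT.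
    have [|s [Cs [_ _ [_ sC] _ _] sr]] := seqC [:: x; y].
      by move=> t; rewrite !inE => /orP[]/eqP->.
    by apply: sC; apply: sr; rewrite !inE eqxx ?orbT.
  + move=> x y Ux Uy; have [|s [Cs [_ _ _ sxx _] sr]] := seqC [:: x; y].
      by move=> t; rewrite !inE => /orP[]/eqP->.
    by apply: sxx; apply: sr; rewrite !inE eqxx ?orbT.
  + move=> b c x y Ux Uy; have [|s [Cs [_ _ _ _ sinj] sr]] := seqC [:: x; y].
      by move=> t; rewrite !inE => /orP[]/eqP->.
    by apply: sinj; apply: sr; rewrite !inE eqxx ?orbT.
exists S, h; split=> // -[j [jS j_inj]].
have nSj x : S x -> ~ S (j x) by move=> /jS.
have j_inj' x y : S x -> S y -> j x = j y -> x = y.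
  by move=> Sx Sy; apply: j_inj; rewrite inE.
have [h' [Sh' [e1 e2]]] := doubling_group_extend Sh nSj j_inj'.
case: Sh => -[x Sx] _ _ _ _; apply: (nSj x Sx).
apply: (hmax _ h' Sh') => /=; last by right; exists x.
split=> [y|[[y z] [Sy Sz]|[b y] Sy]] /=; [by left|exact: e1|exact: e2].
Qed.

(** If S carries a maximal structure, no copy of S fits in its complement, so the
    complement injects into S, and the whole type into S via bool * S. *)
Lemma zmod_of_inhabited (T : Type) : inhabited T ->
  exists (G : zmodType) (e : T -> G), bijective e.
Proof.
move=> T0; have [Tfin|Tinf] := pselect (finite_set [set: T]).
  have [n nP] := Tfin; have [e e_bij] := card_eqTT (card_eq_trans nP card_II).
  case: T0 => x0; case: n {nP} e e_bij => [|n] e e_bij; first by case: (e x0).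
  by exists 'I_n.+1, e.
have [S [h [[S0 [Sop Sp] [opA opC] opxx p_inj] nj]]] :=
  maximal_doubling_group Tinf.
have [x0 Sx0] := S0.
have [//|[k [kS k_inj]]] := injection_total x0 S (~` S).
pose u x := if pselect (S x) then h (inr (false, x)) else h (inr (true, k x)).
have Su x : S (u x).
  by rewrite /u; case: pselect => // nSx; apply: Sp => //; exact: kS.
have u_inj x y : u x = u y -> x = y.
  rewrite /u; case: pselect => Sx; case: pselect => Sy.
  - by move=> /p_inj-/(_ Sx Sy)[].
  - by move=> /p_inj-/(_ Sx (kS _ Sy))[].
  - by move=> /p_inj-/(_ (kS _ Sx) Sy)[].
  - move=> /p_inj-/(_ (kS _ Sx) (kS _ Sy))[_]; apply: k_inj; exact/mem_set.
have TS : [set: T] #= S.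
  rewrite card_eq_le card_leT andbT.
  by apply: (card_le_inj (f := u)) => // x y _ _; exact: u_inj.
have SP (x : S) : S (val x) := set_valP x.
pose op (x y : S) : S := SigSub (mem_set (Sop _ _ (SP x) (SP y))).
have [||||G [e e_bij]] := @boolean_zmod S op.
- by exists; exact: (SigSub (mem_set Sx0)).
- by move=> x y z; apply: val_inj; exact: opA.
- by move=> x y; apply: val_inj; exact: opC.
- by move=> x y; apply: val_inj; exact: opxx.
have [f f_bij] := card_eqTT (card_eq_trans TS (card_esym (card_setT S))).
by exists G, (e \o f); exact: bij_comp.
Qed.
End GroupOnType.

(** * Balanced extensions are affine *)

Section BalancedExtensions.
Local Open Scope classical_set_scope.
Local Open Scope card_scope.
Local Open Scope ring_scope.

Lemma quandle_iso_trans (Q R S : quandleType) :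
  quandle_iso Q R -> quandle_iso R S -> quandle_iso Q S.
Proof.
move=> [f f_bij fM] [g g_bij gM]; exists (g \o f); first exact: bij_comp.
by move=> x y; rewrite /= fM gM.
Qed.

(** Any coset of H holds the same number of indices, so the indices of every coset
    can be labelled bijectively by one and the same group. *)
Lemma balanced_labels (A : zmodType) (H : set A) (I : Type) (d : I -> A) :
  H 0 -> (forall x y, H x -> H y -> H (x - y)) -> inhabited I ->
  add_multitransversal H [set: I] d ->
  exists (G : zmodType) (theta : I -> G),
    (forall i j, H (d i - d j) -> theta i = theta j -> i = j) /\
    (forall a g, exists i, H (d i - a) /\ theta i = g).
Proof.
move=> H0 HB [i0] bal.
have HN x : H x -> H (- x) by move=> Hx; rewrite -sub0r; exact: HB.
pose coset a : set A := [set a + h | h in H].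
have cosetP a b : coset a b <-> H (b - a).
  split=> [[h Hh <-]|Hba]; first by rewrite addrAC subrr add0r.
  by exists (b - a); rewrite // addrC subrK.
pose K a : set I := [set: I] `&` d @^-1` coset a.
have cosetsK a b : K a #= K b by apply: bal; [exists a|exists b].
have K0 : inhabited (K (d i0)).
  exists; exists i0; apply/mem_set; split=> //.
  by apply/cosetP; rewrite subrr.
have [G [e e_bij]] := zmod_of_inhabited K0.
have labels (C : set A) : exists t : I -> G, forall a, C = coset a ->
    (forall i j, C (d i) -> C (d j) -> t i = t j -> i = j) /\
    (forall g, exists i, C (d i) /\ t i = g).
  have [[a ->]|nC] := pselect (exists a, C = coset a); last first.
    by exists (fun=> 0) => a Ca; case: nC; exists a.
  have [f f_bij] := card_bijP (cosetsK a (d i0)).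
  have [h hK Kh] := bij_comp e_bij f_bij.
  pose t i :=
    if pselect (K a i) is left Ki then e (f (SigSub (mem_set Ki))) else 0.
  have tE (i : K a) : t (val i) = e (f i).
    rewrite /t; case: pselect => [Ki|[]]; last exact: set_valP.
    by congr (e (f _)); exact: val_inj.
  exists t => _ _; split=> [i j Ci Cj|g].
    have Ki : K a i by []. have Kj : K a j by [].
    rewrite -[i]/(val (SigSub (mem_set Ki) : K a)).
    rewrite -[j]/(val (SigSub (mem_set Kj) : K a)).
    by rewrite !tE => /(can_inj hK) ->.
  have [_ ChG] := set_valP (h g).
  by exists (val (h g)); split=> //; rewrite tE; exact: Kh.
have [t tP] := choice labels.
have cosetE a b : H (a - b) -> coset a = coset b.
  move=> Hab; apply/seteqP; split=> c /cosetP Hc; apply/cosetP.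
    have -> : c - b = (c - a) - - (a - b) by rewrite opprK subrKA.
    by apply: HB => //; exact: HN.
  have -> : c - a = (c - b) - (a - b) by rewrite opprB subrKA.
  exact: HB.
exists G, (fun i => t (coset (d i)) i); split=> [i j Hij|a g].
  rewrite (cosetE _ _ Hij); have [t_inj _] := tP _ _ (erefl (coset (d j))).
  by apply: t_inj; apply/cosetP; rewrite // subrr.
have [_ t_onto] := tP _ _ (erefl (coset a)).
have [i [/cosetP Hi ti]] := t_onto g.
by exists i; split=> //; rewrite (cosetE _ a).
Qed.

(** With [factor_mono_epi] applied to phi = 1 - f, the affine quandle lives on
    B x G: the automorphism is 1 - Phi on B and the identity on the labels G, and
    (i, a) goes to (c_i + a, theta i) where Phi c_i = d_i. *)
Lemma balanced_ext_affine (A : zmodType) (f : zmodAut A) (I : Type)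
    (I0 : inhabited I) (d : I -> A) :
  tuple_balanced f d -> affine (Ext I0 f d).
Proof.
move=> bal; pose phi : {additive A -> A} := idfun \- f.
have [||G [theta [theta_inj theta_onto]]] := balanced_labels _ _ I0 bal.
- by exists 0; rewrite // raddf0 subr0.
- move=> _ _ [x _ <-] [y _ <-]; exists (x - y) => //.
  by rewrite -![_ - f _]/(phi _) raddfB.
have [B [iota [Phi [iota_inj Phi_onto Phi_iota Phi_ker]]]] :=
  factor_mono_epi phi.
have /choice[c cP] i : exists b, Phi b = d i by exact: Phi_onto.
pose g0 (u : B * G) := (u.1 - iota (Phi u.1), u.2).
have g0B : zmod_morphism g0.
  move=> u v; rewrite /g0 /=; congr (_, _).
  by rewrite !raddfB /= !opprD !opprK addrACA.
pose g : {additive (B * G)%type -> (B * G)%type} :=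
  HB.pack g0 (GRing.isZmodMorphism.Build _ _ g0 g0B).
have g_bij : bijective g.
  have [finv fK fKinv] := aut_bij f.
  exists (fun u => (u.1 + iota (finv (Phi u.1)), u.2)) => -[b x];
    congr (_, _) => /=.
    by rewrite raddfB /= Phi_iota /= subKr fK subrK.
  by rewrite raddfD /= Phi_iota /= fKinv [Phi b + _]addrC subrK addrK.
have kerPhi b : range phi (Phi b) -> exists a, iota a = b.
  move=> [a _ phia]; have [|a' a'E] := Phi_ker (b - iota a).
    by rewrite raddfB /= Phi_iota phia subrr.
  by exists (a' + a); rewrite raddfD /= a'E subrK.
exists (B * G)%type, (ZmodAut g_bij).
pose h (u : Ext I0 f d) : Aff (ZmodAut g_bij) := (c u.1 + iota u.2, theta u.1).
exists h.
  have h_inj : injective h.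
    move=> [i a] [j b] [/= e et].
    have ij : i = j.
      apply: theta_inj et; exists (b - a) => //.
      rewrite -[LHS]/(phi (b - a)) -Phi_iota -!cP -raddfB; congr (Phi _).
      by apply/eqP; rewrite raddfB /= subr_eq addrAC eq_sym subr_eq e addrC.
    by rewrite -ij in e *; move/addrI/iota_inj: e => ->.
  have h_onto v : exists u, h u = v.
    case: v => b x; have [i [Hi ti]] := theta_onto (Phi b) x.
    have [|a aE] := kerPhi (b - c i).
      case: Hi => z _ zE; exists (- z) => //.
      by rewrite [RHS]raddfB /= cP -[RHS]opprB -zE raddfN opprB opprK addrC.
    by exists (i, a); rewrite /h /= aE ti addrC subrK.
  have [k kP] := choice h_onto.
  by exists k => // u; apply: h_inj; rewrite kP.
move=> [i a] [j b].
have PhiE k z : Phi (c k + iota z) = d k + (z - f z).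
  by rewrite raddfD /= cP Phi_iota.
rewrite /h /qop /= /ext_op /aff_op /=; congr (_, _); last first.
  by rewrite /= subrr add0r.
rewrite /= !PhiE subKr -[_ + iota b - _]addrA -raddfB addrCA -raddfD.
congr (c j + iota _).
rewrite opprD opprB [b + _]addrCA [b + _]addrC subrK [d i + _]addrC -!addrA.
by rewrite [f b + _]addrC -addrA.
Qed.
End BalancedExtensions.

(** * Displacement groups *)

Section Generated.
Local Open Scope classical_set_scope.
Local Open Scope group_scope.
Variables (gT : groupType).
Implicit Types (x y : gT) (S H : set gT).

Lemma is_subgroupP H :
  is_subgroup H <-> H 1 /\ forall x y, H x -> H y -> H (x * y^-1).
Proof.
split=> [[/set_mem H1 HV]|[H1 HV]]; (split; first by [|exact/mem_set]) => x y.
  by move=> /mem_set Hx /mem_set Hy; apply/set_mem; exact: HV.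
by move=> /set_mem Hx /set_mem Hy; apply/mem_set; exact: HV.
Qed.

Lemma generated_min S H : is_subgroup H -> S `<=` H -> generated S `<=` H.
Proof. by move=> sgH SH x; apply. Qed.

Lemma sub_generated S : S `<=` generated S.
Proof. by move=> x Sx H [_]; apply. Qed.

Lemma generated_subgroup S : is_subgroup (generated S).
Proof.
apply/is_subgroupP; split=> [|x y Sx Sy] H [/[dup]/is_subgroupP[H1 HV] sgH SH].
  exact: H1.
by apply: HV; [exact: Sx|exact: Sy].
Qed.

End Generated.

Section SymApplication.
Local Open Scope group_scope.
Variable T : Type.

Lemma sym_mulE (g k : sym T) x : (g * k) x = g (k x).
Proof. by []. Qed.

Lemma symVK (g : sym T) x : g (g^-1 x) = x.
Proof. by rewrite -sym_mulE mulgV. Qed.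

Lemma symKV (g : sym T) x : g^-1 (g x) = x.
Proof. by rewrite -sym_mulE mulVg. Qed.

End SymApplication.

Section Transversals.
Local Open Scope classical_set_scope.
Local Open Scope group_scope.
Variable Q : quandleType.
Implicit Types (g : sym Q) (x y : Q) (X : set Q).

Lemma Dis_subgroup : is_subgroup (Dis Q).
Proof. exact: generated_subgroup. Qed.

Lemma ltransV_Dis a b : Dis Q (ltrans a * (ltrans b)^-1).
Proof. by apply: sub_generated; exists (a, b). Qed.

Lemma orbit_refl x : orbit_of (Dis Q) x x.
Proof. by exists 1 => //; have /is_subgroupP[] := Dis_subgroup. Qed.

Lemma orbit_eq x y :
  orbit_of (Dis Q) x y -> orbit_of (Dis Q) x = orbit_of (Dis Q) y.
Proof.
have /is_subgroupP[D1 DV] := Dis_subgroup.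
move=> [g Dg <-]; apply/seteqP; split=> _ [k Dk <-].
  exists (k * g^-1); first exact: DV.
  by rewrite -[LHS]sym_mulE mulgVK.
exists (k * g) => //; rewrite -[g]invgK; apply: (DV) => //.
by rewrite -[g^-1]mul1g; exact: DV.
Qed.

Lemma transversal_meets X x : transversal_of (quandle_orbits Q) X ->
  exists a, X a /\ orbit_of (Dis Q) x a.
Proof.
by move=> /(_ (orbit_of (Dis Q) x))[|a [Xa _]]; [exists x|exists a].
Qed.

Lemma transversal_inj X a b : transversal_of (quandle_orbits Q) X ->
  X a -> X b -> orbit_of (Dis Q) a b -> a = b.
Proof.
move=> /(_ (orbit_of (Dis Q) a))[|c [_ cU]]; first by exists a.
by move=> Xa Xb ab; rewrite -(cU a) ?(cU b) //; split=> //; exact: orbit_refl.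
Qed.

Lemma transversal_exists : exists X, transversal_of (quandle_orbits Q) X.
Proof.
have /choice[r rP] (O : set Q) : exists a, quandle_orbits Q O -> O a.
  have [[x _ <-]|nO] := pselect (quandle_orbits Q O).
    by exists x => _; exact: orbit_refl.
  by have [x] := @quandle_inhabited Q; exists x => /nO.
exists (r @` quandle_orbits Q) => O QO; exists (r O); split.
  by split; [exists O|exact: rP].
move=> _ [[O' QO' <-] Or]; congr r; have := rP _ QO'.
move: QO QO' Or => [x _ <-] [y _ <-] /orbit_eq xE /orbit_eq yE.
exact: etrans xE (esym yE).
Qed.

End Transversals.

(** * Affine quandles *)

Section AffineDisplacements.
Local Open Scope classical_set_scope.
Local Open Scope card_scope.
Local Open Scope group_scope.
Local Open Scope ring_scope.
Variables (Q : quandleType) (A : zmodType) (f : zmodAut A) (h : Q -> A).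
Hypothesis h_bij : bijective h.
Hypothesis hM : forall x y, h (x |> y) = h x - f (h x) + f (h y).

Let phi : {additive A -> A} := idfun \- f.

Let h_inj : injective h := bij_inj h_bij.

Definition translates (g : sym Q) (u : A) := forall x, h (g x) = h x + u.

Lemma translates_inj g k u : translates g u -> translates k u -> g = k.
Proof. by move=> gu ku; apply: symP => x; apply: h_inj; rewrite gu ku. Qed.

Lemma translates1 : translates 1%g 0.
Proof. by move=> x; rewrite addr0. Qed.

Lemma translatesM g k u v :
  translates g u -> translates k v -> translates (g * k)%g (u + v).
Proof. by move=> gu kv x; rewrite sym_mulE gu kv -addrA [v + u]addrC. Qed.

Lemma translatesV g u : translates g u -> translates g^-1%g (- u).
Proof. by move=> gu x; rewrite -{2}(symVK g x) gu addrK. Qed.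

Lemma translates_subgroup (psi : {additive A -> A}) :
  is_subgroup [set g | exists u, translates g (psi u)].
Proof.
apply/is_subgroupP; split=> [|g k [u gu] [v kv]].
  by exists 0; rewrite raddf0; exact: translates1.
by exists (u - v); rewrite raddfB; apply: translatesM => //; exact: translatesV.
Qed.

Lemma translates_ltransV a b :
  translates (ltrans a * (ltrans b)^-1)%g (phi (h a - h b)).
Proof.
move=> x; rewrite sym_mulE -{2}(symVK (ltrans b) x) !hM raddfB /=.
by rewrite [RHS]addrAC; congr (_ + _); rewrite addrC subrK.
Qed.

Lemma DisE g : Dis Q g <-> exists u, translates g (phi u).
Proof.
split.
  apply: (generated_min (translates_subgroup phi)).
  by move=> _ [[a b] _ <-]; exists (h a - h b); exact: translates_ltransV.
move=> [u gu]; have [k hK kK] := h_bij.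
have := @translates_ltransV (k u) (k 0); rewrite !kK subr0.
move=> /(translates_inj gu) ->; apply: sub_generated.
by exists (k u, k 0).
Qed.

(** Conjugating a translation by L_e applies f to it, hence phi = 1 - f here. *)
Lemma translates_commutator g e u : translates g u ->
  translates (commutator g (ltrans e)) (phi u).
Proof.
move=> gu x; rewrite /commutator !sym_mulE -{2}(symVK (ltrans e) x).
set y := (ltrans e)^-1%g x; rewrite gu !hM (translatesV gu) raddfB /=.
by rewrite [u - _]addrC !addrA.
Qed.

Lemma Dis_commE e g : Dis_comm e g <-> exists u, translates g (phi (phi u)).
Proof.
split.
  apply: (generated_min (translates_subgroup (phi \o phi))).
  by move=> _ [k /DisE[u ku] <-]; exists u; exact: translates_commutator.
move=> [u gu]; have [k hK kK] := h_bij.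
pose d := (ltrans (k u) * (ltrans (k 0))^-1)%g.
have du : translates d (phi u).
  by have := @translates_ltransV (k u) (k 0); rewrite !kK subr0.
rewrite (translates_inj gu (translates_commutator e du)).
by apply: sub_generated; exists d => //; apply/DisE; exists u.
Qed.

Lemma Dis_orbitE x y : orbit_of (Dis Q) x y <-> exists u, h y = h x + phi u.
Proof.
split=> [[g /DisE[u gu] <-]|[u yE]]; first by exists u; rewrite gu.
have [k hK kK] := h_bij; pose d := (ltrans (k u) * (ltrans (k 0))^-1)%g.
have du : translates d (phi u).
  by have := @translates_ltransV (k u) (k 0); rewrite !kK subr0.
by exists d; [apply/DisE; exists u|apply: h_inj; rewrite du yE].
Qed.

Lemma affine_Dis_abelian : abelian_set (Dis Q).
Proof.
move=> x y /DisE[u xu] /DisE[v yv].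
apply: (translates_inj (translatesM xu yv)); rewrite addrC.
exact: translatesM.
Qed.

Lemma affine_Dis_semiregular : semiregular (Dis Q).
Proof.
move=> g /DisE[u gu] g1 x gx; apply: g1; apply: translates_inj translates1.
have u0 : phi u = 0 by apply: (addrI (h x)); rewrite -gu gx addr0.
by move: gu; rewrite u0.
Qed.

(** By symmetry and Cantor-Bernstein an injection between the two index sets is
    enough: move a by w' - w and replace it by the representative of its orbit,
    which changes its image under phi by an element of Im phi^2 only. *)
Lemma affine_balanced e X :
  transversal_of (quandle_orbits Q) X -> quandle_balanced e X.
Proof.
move=> tX.
have /choice[r rP] x : exists a, X a /\ orbit_of (Dis Q) x a.
  exact: (transversal_meets x tX).
split=> [a _|]; first exact: ltransV_Dis.
suff le C C' : left_cosets (Dis Q) (Dis_comm e) C ->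
    left_cosets (Dis Q) (Dis_comm e) C' ->
    (X `&` (fun a => ltrans a * (ltrans e)^-1)%g @^-1` C) #<=
    (X `&` (fun a => ltrans a * (ltrans e)^-1)%g @^-1` C').
  by move=> C C' CP CP'; rewrite card_eq_le !le.
have [k hK kK] := h_bij.
have cosetE w g a : translates g (phi w) ->
    [set (g * c)%g | c in Dis_comm e] (ltrans a * (ltrans e)^-1)%g <->
    exists v, phi (h a - h e) = phi w + phi (phi v).
  move=> gw; have aw := translates_ltransV a e.
  split=> [[c /Dis_commE[v cv] gc]|[v av]].
    exists v; apply: (addrI (h e)); rewrite -aw -gc.
    by rewrite (translatesM gw cv).
  exists (g^-1 * (ltrans a * (ltrans e)^-1))%g; last first.
    by rewrite mulgA mulgV mul1g.
  apply/Dis_commE; exists v; rewrite -[phi (phi v)](addKr (phi w)) -av.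
  exact: translatesM (translatesV gw) aw.
move=> [g /DisE[w gw] <-] [g' /DisE[w' gw'] <-].
apply: (card_le_inj (f := fun a => r (k (h a + (w' - w))))).
  move=> a [Xa /(cosetE _ _ _ gw)[v av]].
  have [Xr /Dis_orbitE[u]] := rP (k (h a + (w' - w))).
  rewrite kK => ru; split=> //; apply/(cosetE _ _ _ gw'); exists (v + u).
  have -> : phi (h (r (k (h a + (w' - w)))) - h e) =
      phi (h a - h e) + (phi w' - phi w) + phi (phi u).
    rewrite ru -(raddfB phi w') -!(raddfD phi); congr (phi _).
    by rewrite addrAC; congr (_ + _); rewrite addrAC.
  rewrite av (raddfD phi v) (raddfD phi (phi v)) [RHS]addrA; congr (_ + _).
  by rewrite addrAC [phi w + _]addrC subrK.
move=> a b [Xa _] [Xb _] rab; apply: (transversal_inj tX) => //.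
apply/Dis_orbitE.
have [_ /Dis_orbitE[u]] := rP (k (h a + (w' - w))).
have [_ /Dis_orbitE[v]] := rP (k (h b + (w' - w))).
rewrite rab !kK => -> /esym/eqP; rewrite -subr_eq => /eqP e'.
exists (u - v); apply: (addIr (w' - w)).
by rewrite -e' [RHS]addrAC (raddfB phi) -[LHS]addrA.
Qed.

End AffineDisplacements.

(** * Quandles with abelian semiregular displacement group *)

Section DisplacementExtension.
Local Open Scope classical_set_scope.
Local Open Scope card_scope.
Local Open Scope group_scope.
Local Open Scope ring_scope.

Lemma zmod_of_abelian_subgroup (gT : groupType) (G : set gT) :
  is_subgroup G -> abelian_set G ->
  exists (A : zmodType) (v : A -> gT),
    [/\ injective v, range v = G, (forall a b, v (a + b) = (v a * v b)%g),
        v 0 = 1%g & forall a, v (- a) = (v a)^-1%g].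
Proof.
move=> /is_subgroupP[G1 GV] Gab.
have GI x : G x -> G x^-1%g by move=> Gx; rewrite -[x^-1%g]mul1g; exact: GV.
have GM x y : G x -> G y -> G (x * y)%g.
  by move=> Gx Gy; rewrite -[y]invgK; apply: GV => //; exact: GI.
have GP (x : G) : G (val x) := set_valP x.
pose add (x y : G) : G := SigSub (mem_set (GM _ _ (GP x) (GP y))).
pose opp (x : G) : G := SigSub (mem_set (GI _ (GP x))).
pose zero : G := SigSub (mem_set G1).
have addA : associative add by move=> x y z; apply: val_inj; exact: mulgA.
have addC : commutative add by move=> x y; apply: val_inj; exact: Gab.
have add0 : left_id zero add by move=> x; apply: val_inj; exact: mul1g.
have addN : left_inverse zero opp add by move=> x; apply: val_inj; exact: mulVg.
pose Gc : choiceType := HB.pack (set_type G)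
  (gen_eqMixin (set_type G)) (gen_choiceMixin (set_type G)).
pose A : zmodType := HB.pack Gc
  (GRing.isZmodule.Build Gc addA addC add0 addN).
exists A, (fun x : A => val (x : G)).
split; [exact: val_inj| |by []|by []|by []].
apply/seteqP; split=> [_ [x _ <-]|x Gx]; first exact: GP.
by exists (SigSub (mem_set Gx)).
Qed.

Lemma quandle_iso_sym (Q R : quandleType) : quandle_iso Q R -> quandle_iso R Q.
Proof.
move=> [f [g fK gK] fM]; exists g; first by exists f.
by move=> x y; apply: (can_inj fK); rewrite fM !gK.
Qed.

Lemma Dis_iso (Q R : quandleType) (f : Q -> R) : bijective f ->
    (forall x y, f (x |> y) = f x |> f y) ->
  forall g, Dis Q g -> exists2 g', Dis R g' & forall x, g' (f x) = f (g x).
Proof.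
move=> f_bij fM.
pose H := [set g | exists2 g', Dis R g' & forall x, g' (f x) = f (g x)].
have /is_subgroupP[R1 RV] := Dis_subgroup R.
suff : Dis Q `<=` H by [].
have inv (g : sym Q) (g' : sym R) : (forall x, g' (f x) = f (g x)) ->
    forall x, g'^-1%g (f x) = f (g^-1%g x).
  move=> gg' x; rewrite -{1}(symVK g x) -gg'.
  by rewrite symKV.
apply: generated_min.
  apply/is_subgroupP; split; first by exists 1%g.
  move=> g k [g' g'D gg'] [k' k'D kk']; exists (g' * k'^-1)%g; first exact: RV.
  by move=> x; rewrite !sym_mulE (inv _ _ kk') gg'.
move=> _ [[a b] _ <-]; exists (ltrans (f a) * (ltrans (f b))^-1)%g.
  exact: ltransV_Dis.
have lf c x : ltrans (f c) (f x) = f (ltrans c x) by rewrite /= fM.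
by move=> x; rewrite !sym_mulE (inv _ _ (lf b)) lf.
Qed.

Lemma ltransJ (Q : quandleType) (a b : Q) :
  (ltrans a * ltrans b * (ltrans a)^-1)%g = ltrans (a |> b).
Proof.
apply: symP => x; rewrite !sym_mulE /= qop_dist; congr (_ |> _).
exact: (symVK (ltrans a) x).
Qed.

Lemma conj_subgroup (gT : groupType) (G : set gT) (y : gT) : is_subgroup G ->
  is_subgroup [set x | G (y * x * y^-1)%g].
Proof.
move=> /is_subgroupP[G1 GV]; apply/is_subgroupP; split=> [|x z Gx Gz].
  by rewrite /= mulg1 mulgV.
have := GV _ _ Gx Gz; rewrite !invgM invgK => Gxz.
move: Gxz; rewrite /= !mulgA mulgVK.
by [].
Qed.

Lemma Dis_conj (Q : quandleType) (e : Q) g :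
  Dis Q g -> Dis Q (ltrans e * g * (ltrans e)^-1)%g.
Proof.
apply: (generated_min (conj_subgroup (ltrans e) (Dis_subgroup Q))).
move=> _ [[a b] _ <-] /=; apply: sub_generated; exists (e |> a, e |> b) => //=.
by rewrite -!ltransJ !invgM invgK !mulgA mulgVK.
Qed.

Lemma Dis_conjV (Q : quandleType) (e : Q) g :
  Dis Q g -> Dis Q ((ltrans e)^-1 * g * ltrans e)%g.
Proof.
rewrite -{2}[ltrans e]invgK.
apply: (generated_min (conj_subgroup (ltrans e)^-1%g (Dis_subgroup Q))).
move=> _ [[a b] _ <-] /=; apply: sub_generated.
exists (((ltrans e)^-1%g a), ((ltrans e)^-1%g b)) => //=.
have lE c :
    ltrans ((ltrans e)^-1%g c) = ((ltrans e)^-1 * ltrans c * ltrans e)%g.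
  have := ltransJ e ((ltrans e)^-1%g c).
  rewrite -[e |> _]/(ltrans e _) symVK => <-.
  by rewrite -!mulgA mulVg mulg1 mulKg.
by rewrite !lE !invgM !invgK !mulgA mulgK.
Qed.

Lemma Dis_auto (Q : quandleType) (g : sym Q) : Dis Q g ->
  forall x y, g (x |> y) = g x |> g y.
Proof.
have aut_subgroup :
    is_subgroup [set g : sym Q | forall x y, g (x |> y) = g x |> g y].
  apply/is_subgroupP; split=> // k l kM lM x y.
  rewrite !sym_mulE -kM; congr (k _).
  by rewrite -{1}(symVK l x) -{1}(symVK l y) -lM symKV.
apply: (generated_min aut_subgroup) => _ [[a b] _ <-] x y.
rewrite !sym_mulE -[ltrans a _ |> _]qop_dist; congr (a |> _).
by rewrite -{1}(symVK (ltrans b) x) -{1}(symVK (ltrans b) y) -qop_dist symKV.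
Qed.

Lemma Dis_ltrans (Q : quandleType) (g : sym Q) x : Dis Q g ->
  ltrans (g x) = (g * ltrans x * g^-1)%g.
Proof.
move=> Dg; apply: symP => y; rewrite !sym_mulE -[RHS]/(g (x |> _)).
by rewrite Dis_auto // symVK.
Qed.

(** The group A is Dis(Q) written additively, through the injection v, with f the
    conjugation by L_e.  Then 1 - f is the commutator with L_e, so Im(1 - f) is
    the whole of [Dis_comm e] and the two notions of balance agree.  The map
    (a, g) |-> g a is onto by transversality and one-to-one by semiregularity. *)
Lemma Dis_balanced_ext (Q : quandleType) (e : Q) (X : set Q) :
  abelian_set (Dis Q) -> semiregular (Dis Q) ->
  transversal_of (quandle_orbits Q) X -> quandle_balanced e X ->
  exists (A : zmodType) (f : zmodAut A) (I : Type) (I0 : inhabited I)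
         (d : I -> A),
    [/\ tuple_balanced f d, quandle_iso Q (Ext I0 f d) & indecomposable I0 f d].
Proof.
move=> Dab Dsr tX [_ bal]; set L := ltrans e in bal *.
have [A [v [v_inj vD vM v1 vV]]] :=
  zmod_of_abelian_subgroup (Dis_subgroup Q) Dab.
have Dv a : Dis Q (v a) by rewrite -vD; exists a.
have vP g : Dis Q g -> exists a, v a = g by rewrite -vD => -[a _ <-]; exists a.
have /choice[f0 f0P] a := vP _ (Dis_conj e (Dv a)).
have /choice[f0V f0VP] a := vP _ (Dis_conjV e (Dv a)).
have f0B : zmod_morphism f0.
  move=> a b; apply: v_inj; rewrite vM vV !f0P vM vV -/L !invgM invgK.
  by rewrite !mulgA mulgVK.
pose f1 : {additive A -> A} := HB.pack f0
  (GRing.isZmodMorphism.Build A A f0 f0B).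
have f1_bij : bijective f1.
  exists f0V => a; apply: v_inj; rewrite ?f0VP f0P ?f0VP -/L !mulgA.
    by rewrite mulVg mul1g mulgVK.
  by rewrite mulgV mul1g mulgK.
pose f := ZmodAut f1_bij; pose I := set_type X.
have /choice[d dP] (i : I) : exists a, v a = (ltrans (val i) * L^-1)%g.
  by apply: vP; exact: ltransV_Dis.
have I0 : inhabited I.
  have [a [Xa _]] := transversal_meets e tX.
  by exists; exists a; exact/mem_set.
have vsub1 a : v (a - f a) = commutator (v a) L.
  by rewrite vM vV f0P -/L /commutator !invgM invgK !mulgA.
have DcE : Dis_comm e = v @` sub1_image f.
  apply/seteqP; split.
    apply: generated_min.
      apply/is_subgroupP; split.
        by exists 0 => //; exists 0; rewrite // raddf0 subr0.
      move=> _ _ [_ [a _ <-] <-] [_ [b _ <-] <-].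
      exists ((a - b) - f (a - b)); first by exists (a - b).
      by rewrite -vV -vM raddfB /= !opprD !opprK addrACA.
    move=> _ [g /vP[a <-] <-]; exists (a - f a) => //; by exists a.
  move=> _ [_ [a _ <-] <-]; rewrite vsub1; apply: sub_generated.
  by exists (v a).
exists A, f, I, I0, d.
pose k (p : Ext I0 f d) : Q := v p.2 (val p.1).
have kM p q : k (p |> q) = k p |> k q.
  case: p q => [i a] [j b].
  change (v (a - f a + f b + d i - d j) (val j) = v a (val i) |> v b (val j)).
  rewrite -[v a _ |> _]/(ltrans _ (v b (val j))) Dis_ltrans //.
  set Li := ltrans (val i); set Lj := ltrans (val j).
  (* L_i c = L c L^-1 L_i for every displacement c, because L^-1 L_i is a
     displacement and Dis(Q) is abelian. *)
  pose c := ((v a)^-1 * v b)%g; pose delta := (L^-1 * Li)%g.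
  have cdelta : (c * delta = delta * c)%g.
    apply: Dab; first by rewrite /c -vV -vM.
    by have := Dis_conjV e (ltransV_Dis (val i) e); rewrite mulgA mulgVK.
  have Ljj : Lj^-1%g (val j) = val j by rewrite -{1}[val j]qopxx symKV.
  rewrite -{2}Ljj -!sym_mulE; congr (symval _ (val j)).
  have -> : v (a - f a + f b + d i - d j) = (v a * L * (c * delta) * Lj^-1)%g.
    rewrite vM vV !dP vM dP vM vsub1 f0P -/L -/Li -/Lj /commutator /c /delta.
    by rewrite !invgM invgK !mulgA !mulgVK.
  by rewrite cdelta /delta /c !mulgA mulgK.
have k_inj : injective k.
  move=> [i a] [j b]; rewrite /k /= => e1.
  have ij : i = j.
    apply: val_inj; apply: (transversal_inj tX); try exact: set_valP.
    exists (v (- b + a)) => //.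
    by rewrite vM sym_mulE e1 -sym_mulE -vM addNr v1.
  move: e1; rewrite -ij => e1; congr (_, _); apply/eqP; rewrite -subr_eq0 addrC.
  apply/eqP; apply: contrapT => ab.
  apply: (Dsr _ (Dv (- b + a)) _ (val i)) => [|/=].
    by rewrite -v1 => /v_inj.
  by rewrite vM sym_mulE e1 -sym_mulE -vM addNr v1.
have k_onto x : exists p, k p = x.
  have [a [Xa [g Dg ga]]] := transversal_meets x tX.
  have [b bg] := vP _ Dg; exists (SigSub (mem_set Xa), - b).
  by rewrite /k /= vV bg -ga symKV.
have k_bij : bijective k.
  have [k' k'P] := choice k_onto.
  by exists k' => // p; apply: k_inj; rewrite k'P.
have iso : quandle_iso Q (Ext I0 f d).
  by apply: quandle_iso_sym; exists k.
have [k' kK k'K] := k_bij.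
split => //.
- suff cosetE (C : set A) : val @` ([set: I] `&` d @^-1` C) =
      X `&` (fun a => ltrans a * L^-1)%g @^-1` (v @` C).
    have vC C : add_cosets (sub1_image f) C ->
        left_cosets (Dis Q) (Dis_comm e) (v @` C).
      move=> [a _ <-]; exists (v a); rewrite // DcE; apply/seteqP; split.
        by move=> _ [_ [c cf <-] <-]; exists (a + c); [exists c|rewrite vM].
      by move=> _ [_ [c cf <-] <-]; exists (v c); [exists c|rewrite vM].
    move=> C C' /vC vCc /vC vCc'; have := bal _ _ vCc vCc'.
    rewrite -!cosetE => CC'.
    have val_card (S : set I) : val @` S #= S.
      by apply: inj_card_eq => x y _ _; exact: val_inj.
    by rewrite -(card_eql (val_card _)) -(card_eqr (val_card _)).
  apply/seteqP; split=> [_ [i [_ Ci] <-]|a [Xa [c Cc ca]]].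
    by split; [exact: set_valP|exists (d i); rewrite // dP].
  exists (SigSub (mem_set Xa)) => //; split=> //=.
  rewrite (_ : d _ = c) //; apply: v_inj; rewrite dP /= ca //.
have Dis_fst : Dis (Ext I0 f d) `<=` [set g | forall p, (g p).1 = p.1].
  apply: generated_min.
    apply/is_subgroupP; split=> // g g' gE g'E p.
    by rewrite sym_mulE gE -[in RHS](symVK g' p) g'E.
  by move=> _ [[r s] _ <-] p; rewrite sym_mulE /= -[in RHS](symVK (ltrans s) p).
have k'M x y : k' (x |> y) = k' x |> k' y.
  by apply: (can_inj kK); rewrite kM !k'K.
have orbitE p : orbit_of (Dis (Ext I0 f d)) p = @ext_fiber _ I0 _ f d p.1.
  apply/seteqP; split=> [_ [g Dg <-]|q pq]; first exact: Dis_fst.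
  have [g Dg gE] := Dis_iso (Bijective k'K kK) k'M (Dv (q.2 - p.2)).
  exists g => //; rewrite -[p]kK gE -[RHS]kK; congr (k' _).
  by rewrite /k -sym_mulE -vM subrK pq.
apply/seteqP; split=> [_ [p _ <-]|_ [i _ <-]]; first by exists p.1.
by exists (i, 0); rewrite // orbitE.
Qed.

End DisplacementExtension.

Theorem theorem2p3 (Q : quandleType) :
  [<->
    affine Q;
    abelian_set (Dis Q) /\ semiregular (Dis Q) /\
      (forall (e : Q) (X : set Q),
         transversal_of (quandle_orbits Q) X -> quandle_balanced e X);
    abelian_set (Dis Q) /\ semiregular (Dis Q) /\
      (exists (e : Q) (X : set Q),
         transversal_of (quandle_orbits Q) X /\ quandle_balanced e X);
    exists (A : zmodType) (f : zmodAut A) (I : Type) (I0 : inhabited I)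
           (d : I -> A),
      tuple_balanced f d /\ quandle_iso Q (Ext I0 f d)]
  /\
  ((exists (A : zmodType) (f : zmodAut A) (I : Type) (I0 : inhabited I)
           (d : I -> A),
      tuple_balanced f d /\ quandle_iso Q (Ext I0 f d)) ->
   exists (A : zmodType) (f : zmodAut A) (I : Type) (I0 : inhabited I)
          (d : I -> A),
     [/\ tuple_balanced f d, quandle_iso Q (Ext I0 f d)
       & indecomposable I0 f d]).
Proof.
have aff_bal : affine Q -> abelian_set (Dis Q) /\ semiregular (Dis Q) /\
    (forall (e : Q) (X : set Q),
       transversal_of (quandle_orbits Q) X -> quandle_balanced e X).
  move=> [A [f [h h_bij hM]]]; split; first exact: affine_Dis_abelian h_bij hM.
  split; first exact: affine_Dis_semiregular h_bij hM.
  by move=> e X; exact: affine_balanced h_bij hM _ _.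
have all_some : abelian_set (Dis Q) /\ semiregular (Dis Q) /\
    (forall (e : Q) (X : set Q),
       transversal_of (quandle_orbits Q) X -> quandle_balanced e X) ->
    abelian_set (Dis Q) /\ semiregular (Dis Q) /\
    (exists (e : Q) (X : set Q),
       transversal_of (quandle_orbits Q) X /\ quandle_balanced e X).
  move=> [Dab [Dsr bal]]; split=> //; split=> //.
  have [e] := @quandle_inhabited Q; have [X tX] := transversal_exists Q.
  by exists e, X; split=> //; exact: bal.
have ext_aff : (exists (A : zmodType) (f : zmodAut A) (I : Type)
    (I0 : inhabited I) (d : I -> A),
    tuple_balanced f d /\ quandle_iso Q (Ext I0 f d)) -> affine Q.
  move=> [A [f [I [I0 [d [bal iso]]]]]].
  have [B [g iso']] := balanced_ext_affine I0 bal.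
  by exists B, g; exact: quandle_iso_trans iso iso'.
split.
  tfae=> //.
  move=> [Dab [Dsr [e [X [tX bal]]]]].
  have [A [f [I [I0 [d [dbal iso _]]]]]] := Dis_balanced_ext Dab Dsr tX bal.
  by exists A, f, I, I0, d.
move=> /ext_aff/aff_bal/all_some[Dab [Dsr [e [X [tX bal]]]]].
exact: Dis_balanced_ext Dab Dsr tX bal.
Qed.
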